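(* Assume the weighted digraph $V$ on vertex set $\mathcal N$ ($|\mathcal N|=N$) has at least one spanning tree, and let $2\le k\le N$. Then for every minimal forest $F\in\tilde{\mathcal F}^{k-1}$ and every atom $\mathcal E$ of the algebra $\mathfrak A_k$, the induced subgraph $F|_{\mathcal E}$ is a tree.
   Context: $V$ is a digraph with vertex set $\mathcal N$ and real weights $v_{ij}$ on its arcs $(i,j)$. An (entering) forest is a digraph in which every vertex has at most one outgoing arc and which contains no directed cycle; its weakly connected components are called trees; the unique vertex of a tree with no outgoing arc is its root. A spanning forest is a forest which is a subgraph of $V$ with vertex set $\mathcal N$; $\mathcal F^k$ denotes the set of spanning forests consisting of exactly $k$ trees. For a subgraph $G$ of $V$, $\Upsilon^G=\sum_{(i,j)\in\mathcal AG}v_{ij}$. Put $\phi^k=\min_{F\in\mathcal F^k}\Upsilon^F$ and $\tilde{\mathcal F}^k=\{F\in\mathcal F^k:\Upsilon^F=\phi^k\}$. $\mathfrak A_k$ is the algebra of subsets of $\mathcal N$ generated (by complements and intersections) by the vertex sets of all trees of all forests in $\tilde{\mathcal F}^k$; an atom is a nonempty $\mathcal A\in\mathfrak A_k$ with $\mathcal A\cap\mathcal B\in\{\emptyset,\mathcal A\}$ for all $\mathcal B\in\mathfrak A_k$. $G|_{\mathcal S}$ denotes the subgraph of $G$ induced by $\mathcal S$. A single vertex with no arcs counts as a tree. *)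

(* Defs.v *)
From mathcomp Require Import all_boot all_order all_algebra.
Set Implicit Arguments. Unset Strict Implicit. Unset Printing Implicit Defensive.
Import Order.TTheory GRing.Theory Num.Theory.

Section Graphs.
Variable T : finType.

(* A subgraph is given by an arc set A : {set T * T}; (i,j) \in A is arc i -> j. *)
Definition arel (A : {set T * T}) : rel T := fun x y => (x, y) \in A.
Definition symrel (A : {set T * T}) : rel T :=
  fun x y => ((x, y) \in A) || ((y, x) \in A).

Definition is_forest_arcs (A : {set T * T}) : Prop :=
  (forall x, #|[set y | (x, y) \in A]| <= 1)%N /\
  ~ (exists x y, (x, y) \in A /\ connect (arel A) y x).

Definition is_tree (S : {set T}) (A : {set T * T}) : Prop :=
  A \subset setX S S /\ is_forest_arcs A /\ S != set0 /\
  (forall x y, x \in S -> y \in S -> connect (symrel A) x y).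

Definition induced (A : {set T * T}) (S : {set T}) : {set T * T} :=
  [set a in A | (a.1 \in S) && (a.2 \in S)].

Definition tree_sets (A : {set T * T}) : {set {set T}} :=
  [set [set y | connect (symrel A) x y] | x : T].

Definition spanning_forest (Varc : rel T) (F : {set T * T}) : Prop :=
  F \subset [set a | Varc a.1 a.2] /\ is_forest_arcs F.

Definition forest_k (Varc : rel T) (k : nat) (F : {set T * T}) : Prop :=
  spanning_forest Varc F /\ #|tree_sets F| = k.

Definition has_spanning_tree (Varc : rel T) : Prop :=
  exists F, forest_k Varc 1 F.

Definition Upsilon (R : realFieldType) (v : T -> T -> R) (A : {set T * T}) : R :=
  (\sum_(a in A) v a.1 a.2)%R.

Definition minimal_forest (R : realFieldType) (Varc : rel T) (v : T -> T -> R)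
    (k : nat) (F : {set T * T}) : Prop :=
  forest_k Varc k F /\
  (forall G, forest_k Varc k G -> (Upsilon v F <= Upsilon v G)%R).

Definition gen_alg (Gen : {set T} -> Prop) (S : {set T}) : Prop :=
  forall C : {set {set T}},
    (forall B, Gen B -> B \in C) ->
    (forall B, B \in C -> ~: B \in C) ->
    (forall B1 B2, B1 \in C -> B2 \in C -> B1 :&: B2 \in C) ->
    S \in C.

Definition alg_k (R : realFieldType) (Varc : rel T) (v : T -> T -> R) (k : nat)
    : {set T} -> Prop :=
  gen_alg (fun B => exists F, minimal_forest Varc v k F /\ B \in tree_sets F).

Definition is_atom (Alg : {set T} -> Prop) (E : {set T}) : Prop :=
  E != set0 /\ Alg E /\
  (forall B, Alg B -> E :&: B = set0 \/ E :&: B = E).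

End Graphs.

(* Main.v *)
Require Import Defs.
From mathcomp Require Import all_boot all_order all_algebra.
Set Implicit Arguments. Unset Strict Implicit. Unset Printing Implicit Defensive.
Import Order.TTheory GRing.Theory Num.Theory.

(** A forest is a function sending each vertex to the head of its outgoing arc,
    or to [None] at a root.  If [S] is a tree of one of two forests [f], [g],
    exchanging [f] and [g] on [S] gives two forests of the same total weight.
    Such exchanges show that the minimal weight is convex in the number of
    roots; hence, with the penalty [phi^(k-1) - phi^k] per root, the minimal
    forests with [k - 1] and with [k] roots are exactly the forests with that
    many roots that are optimal for the penalized weight.

    Call two vertices inseparable if every optimal forest puts them in one
    tree.  For a class [E] of inseparable vertices take a smallest set [S]
    containing [E], of the same cost in every optimal forest, such that two
    optimal forests [A], [B] that agree outside [S], from where they never enter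
    [S], send all of [S] to the root [r], respectively nothing of [S] to [r].
    By minimality any optimal [H] agreeing with them outside [S] sends all or
    nothing of [S] to [r].  Applied to [F] on one component of its restriction
    to [S], and [A] or [B] elsewhere, this shows that every component contains
    a given vertex; so [F] restricted to [S] is connected, and [S = E].

    It remains to see that vertices separated by some optimal forest are
    separated by one with exactly [k] roots: roots can be added, and can be
    removed as long as some optimal forest has at least two roots less. *)

(** * Functional forests *)
Section FunctionalForests.
Variable T : finType.
Implicit Types (f g h : {ffun T -> option T}) (S P U : {set T}) (x y z r : T).

Definition reach f : rel T := connect (fun x y => f x == Some y).

(** Acyclicity is encoded as termination: for a function on a finite set, having no cycle amounts to
    every vertex reaching a root. *)
Definition acyc f := [forall x, [exists r, reach f x r && (f r == None)]].

Definition rootof f x := odflt x [pick r | reach f x r && (f r == None)].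

Definition rootset f := [set x | f x == None].

Definition mix P f g : {ffun T -> option T} :=
  [ffun x => if x \in P then f x else g x].

Definition restrict S f : {ffun T -> option T} :=
  [ffun x => if f x is Some y then if (x \in S) && (y \in S) then Some y else None
             else None].

(** For [x] in [S] and acyclic [f], the last vertex of the path from [x] before it first departs
    from [S], or its root if it never does. *)
Definition term S f x := rootof (restrict S f) x.

Definition noenter f S := forall x y, x \notin S -> f x = Some y -> y \notin S.

Definition stays f S := forall x y, x \in S -> f x = Some y -> y \in S.

Lemma mixT P f g x : x \in P -> mix P f g x = f x.
Proof. by rewrite ffunE => ->. Qed.

Lemma mixN P f g x : x \notin P -> mix P f g x = g x.
Proof. by rewrite ffunE => /negbTE ->. Qed.

Lemma mixC P f g : mix (~: P) f g = mix P g f.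
Proof. by apply/ffunP => x; rewrite !ffunE inE; case: (x \in P). Qed.

Lemma reach_refl f x : reach f x x. Proof. exact: connect0. Qed.

Lemma reach_trans f x y z : reach f x y -> reach f y z -> reach f x z.
Proof. exact: connect_trans. Qed.

Lemma reach_step f x y z : f x = Some y -> reach f y z -> reach f x z.
Proof. by move=> fx; apply: connect_trans; apply: connect1; rewrite fx. Qed.

Lemma reachP f x z : reach f x z -> x = z \/ exists2 y, f x = Some y & reach f y z.
Proof.
case/connectP => [[|y p]] /=; first by move=> _ ->; left.
case/andP => /eqP fx hp ->; right; exists y => //; apply/connectP.
by exists p.
Qed.

Lemma reach_root f x z : f x = None -> reach f x z -> z = x.
Proof. by move=> fx /reachP [//|[y]]; rewrite fx. Qed.

Lemma acyc_ind f : acyc f -> forall Q : T -> Prop,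
  (forall x, (forall y, f x = Some y -> Q y) -> Q x) -> forall x, Q x.
Proof.
move=> /forallP ac Q step x; have /existsP [r /andP [xr /eqP fr]] := ac x.
case/connectP: xr => p; elim: p x => [|y p IH] x /=.
  by move=> _ rx; apply: step => y; rewrite -rx fr.
case/andP => /eqP fx hp rp; apply: step => z; rewrite fx => -[<-].
exact: IH.
Qed.

Lemma terminates_step f : (forall x, (forall y, f x = Some y ->
    [exists r, reach f y r && (f r == None)]) ->
  [exists r, reach f x r && (f r == None)]).
Proof.
move=> x IH; case fx: (f x) => [y|]; last first.
  by apply/existsP; exists x; rewrite reach_refl fx /=.
have /existsP [r /andP [yr fr]] := IH _ fx.
by apply/existsP; exists r; rewrite fr (reach_step fx yr).
Qed.

Lemma acyc_rank f (rk : T -> nat) :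
  (forall x y, f x = Some y -> rk y < rk x) -> acyc f.
Proof.
move=> Hrk; apply/forallP => x; have [n] := ubnP (rk x).
elim: n x => // n IH x; rewrite ltnS => xn; apply: terminates_step => y fx.
by apply: IH; apply: leq_trans (Hrk _ _ fx) xn.
Qed.

Lemma rootof_stop f x : f x = None -> rootof f x = x.
Proof.
move=> fx; rewrite /rootof; case: pickP => [r /andP [xr _]|//] /=.
exact: reach_root fx xr.
Qed.

Lemma rootof_step f x y : acyc f -> f x = Some y -> rootof f x = rootof f y.
Proof.
move=> ac fx; have [r Hr] := existsP (forallP ac y).
rewrite /rootof.
have -> : [pick r | reach f x r && (f r == None)] =
          [pick r | reach f y r && (f r == None)].
  apply: eq_pick => z /=; case: eqP => [fz|]; rewrite ?andbF ?andbT //.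
  apply/idP/idP => [/reachP [xz|[y']]|]; last exact: reach_step.
    by move: fz; rewrite -xz fx.
  by rewrite fx => -[->].
by case: pickP => // /(_ r); rewrite Hr.
Qed.

Lemma rootof_none f x : acyc f -> f (rootof f x) = None.
Proof.
move=> ac; rewrite /rootof; case: pickP => [r /andP [_ /eqP //]|/= no].
by have [r Hr] := existsP (forallP ac x); move: (no r); rewrite Hr.
Qed.

Lemma reach_rootof f x : acyc f -> reach f x (rootof f x).
Proof.
move=> ac; rewrite /rootof; case: pickP => [r /andP [//]|/= no].
exact: reach_refl.
Qed.

Lemma rootof_reach f x y : acyc f -> reach f x y -> rootof f x = rootof f y.
Proof.
move=> ac; elim/(acyc_ind ac): x => x IH /reachP [-> //|[z fx zy]].
by rewrite (rootof_step ac fx) (IH _ fx zy).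
Qed.

Lemma reach_acyc f x y : acyc f -> f x = Some y -> ~~ reach f y x.
Proof.
move=> ac; elim/(acyc_ind ac): x y => x IH y fx; apply/negP => yx.
have yy : y <> x.
  move=> yx'; rewrite yx' in fx.
  by have := IH _ fx _ fx; rewrite reach_refl.
case/reachP: (yx) => [//|[z fy zx]].
by have /negP := IH _ fx _ fy; apply; apply: reach_trans zx (reach_step fx (reach_refl _ _)).
Qed.

Lemma noenterC f S : noenter f S <-> stays f (~: S).
Proof.
by split=> H x y; have := H x y; rewrite !inE.
Qed.

Lemma reach_stays f S x y : stays f S -> x \in S -> reach f x y -> y \in S.
Proof.
move=> st xS /connectP [p]; elim: p x xS => [|z p IH] x xS /=; first by move=> _ ->.
by case/andP => /eqP fx; apply: IH; apply: st fx.
Qed.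

Lemma rootof_stays f S x : acyc f -> stays f S -> x \in S -> rootof f x \in S.
Proof. by move=> ac st xS; apply: reach_stays st xS (reach_rootof _ ac). Qed.

(* The vertices of [U] follow [g] to a root, then those of [P] follow [f] to a
   root or to [U], and all others follow [g] to a root or to [P]. *)
Lemma mix_acyc P U f g : acyc f -> acyc g -> [disjoint U & P] -> stays g U ->
  (forall x y, x \in P -> f x = Some y -> y \in P :|: U) -> acyc (mix P f g).
Proof.
move=> af ag dUP stU exP; set h := mix P f g; apply/forallP.
have hU x : x \in U -> h x = g x.
  by move=> xU; rewrite mixN // (disjointFr dUP xU).
have goodU x : x \in U -> [exists r, reach h x r && (h r == None)].
  elim/(acyc_ind ag): x => x IH xU; apply: terminates_step => y; rewrite hU // => gx.
  by apply: IH (gx) _; apply: stU gx.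
have goodP x : x \in P -> [exists r, reach h x r && (h r == None)].
  elim/(acyc_ind af): x => x IH xP; apply: terminates_step => y; rewrite mixT // => fx.
  by have := exP _ _ xP fx; rewrite inE => /orP [/(IH _ fx)|/goodU].
elim/(acyc_ind ag) => x IH; have [/goodP //|xP] := boolP (x \in P).
by apply: terminates_step => y; rewrite mixN //; apply: IH.
Qed.

Lemma mix_acyc_noenter P f g : acyc f -> acyc g -> noenter g P -> acyc (mix P f g).
Proof.
move=> af ag /noenterC st; apply: (@mix_acyc P (~: P)) => //.
  by rewrite -setI_eq0 setIC setICr.
by move=> x y _ _; rewrite setUCr inE.
Qed.

Lemma mix_acyc_stays P f g : acyc f -> acyc g -> stays f P -> acyc (mix P f g).
Proof.
move=> af ag st; apply: (@mix_acyc P set0) => //.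
- by rewrite -setI_eq0 set0I.
- by move=> x y; rewrite inE.
- by move=> x y xP /(st _ _ xP); rewrite setU0.
Qed.

Lemma rootof_eqin f g P x : acyc f -> acyc g -> stays f P ->
  {in P, f =1 g} -> x \in P -> rootof f x = rootof g x.
Proof.
move=> af ag st eqfg; elim/(acyc_ind af): x => x IH xP.
case fx: (f x) => [y|]; have gx := fx; rewrite eqfg // in gx.
  by rewrite (rootof_step af fx) (rootof_step ag gx) IH //; apply: st fx.
by rewrite !rootof_stop.
Qed.

(** * Restriction to a vertex set *)

Lemma restrictE S f x : restrict S f x =
  if f x is Some y then if (x \in S) && (y \in S) then Some y else None else None.
Proof. by rewrite ffunE. Qed.

Lemma restrict_some S f x y : restrict S f x = Some y ->
  [/\ f x = Some y, x \in S & y \in S].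
Proof. by rewrite restrictE; case: (f x) => // z; case: andP => // -[xS zS] [<-]. Qed.

Lemma acyc_restrict S f : acyc f -> acyc (restrict S f).
Proof.
move=> af; apply/forallP; elim/(acyc_ind af) => x IH; apply: terminates_step => y.
by case/restrict_some => /IH.
Qed.

Lemma term_in S f x : acyc f -> x \in S -> term S f x \in S.
Proof.
move=> af xS; apply: rootof_stays (acyc_restrict _ af) _ xS.
by move=> a b _ /restrict_some [].
Qed.

Lemma term_exit S f x y : acyc f -> x \in S -> f (term S f x) = Some y -> y \notin S.
Proof.
move=> af xS ft; have := rootof_none x (acyc_restrict S af).
by rewrite restrictE -/(term S f x) ft term_in //=; case: (y \in S).
Qed.

Lemma term_step S f x y : acyc f -> x \in S -> y \in S -> f x = Some y ->
  term S f x = term S f y.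
Proof.
move=> af xS yS fx; apply: rootof_step (acyc_restrict _ af) _.
by rewrite restrictE fx xS yS.
Qed.

Lemma term_stop S f x : (forall y, f x = Some y -> y \notin S) -> term S f x = x.
Proof.
move=> H; apply: rootof_stop; rewrite restrictE.
by case fx: (f x) => [y|//]; rewrite (negbTE (H _ fx)) andbF.
Qed.

Lemma reach_term S f x : acyc f -> x \in S -> reach f x (term S f x).
Proof.
move=> af; elim/(acyc_ind af): x => x IH xS; case fx: (f x) => [y|]; last first.
  by rewrite term_stop ?reach_refl // => y; rewrite fx.
have [yS|yS] := boolP (y \in S).
  by rewrite (term_step af xS yS fx); apply: reach_step fx (IH _ fx yS).
by rewrite term_stop ?reach_refl // => z; rewrite fx => -[<-].
Qed.

Lemma rootof_term S f x : acyc f -> x \in S -> rootof f (term S f x) = rootof f x.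
Proof. by move=> af xS; rewrite (rootof_reach af (reach_term af xS)). Qed.

Lemma reach_through_term S f x z : acyc f -> x \in S -> reach f x z ->
  z \in S \/ reach f (term S f x) z.
Proof.
move=> af; elim/(acyc_ind af): x => x IH xS /reachP [<-|[y fx yz]]; first by left.
have [yS|yS] := boolP (y \in S).
  by rewrite (term_step af xS yS fx); apply: IH.
right; rewrite term_stop; first exact: reach_step fx yz.
by move=> w; rewrite fx => -[<-].
Qed.

Lemma last_visit f S x w : acyc f -> reach f x w -> w \in S ->
  exists z, [/\ reach f x z, z \in S &
    forall y w', f z = Some y -> reach f y w' -> w' \notin S].
Proof.
move=> af; elim/(acyc_ind af): x w => x IH w xw wS.
have [/existsP [y /andP [/eqP fx /existsP [w' /andP [yw' w'S]]]]|/existsPn no] :=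
  boolP [exists y, (f x == Some y) && [exists w', reach f y w' && (w' \in S)]].
  have [z [yz zS Hz]] := IH _ fx _ yw' w'S.
  by exists z; split=> //; apply: reach_step fx yz.
have {}no y w' : f x = Some y -> reach f y w' -> w' \notin S.
  move=> fx yw'; have := no y; rewrite fx eqxx /= => /existsPn /(_ w').
  by rewrite yw'.
exists x; split=> //; first exact: reach_refl.
case/reachP: xw => [-> //|[y fx yw]].
by move: (no _ _ fx yw); rewrite wS.
Qed.

Lemma card_roots_mix P f g :
  #|rootset (mix P f g)| = #|rootset f :&: P| + #|rootset g :\: P|.
Proof.
rewrite -(cardsID P); congr (_ + _); apply: eq_card => x; rewrite !inE ffunE.
  by case: (x \in P); rewrite ?andbF.
by case: (x \in P).
Qed.

(** * Trees as vertex sets and exchanges on a tree *)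

Definition treeset f r := [set x | rootof f x == r].

Lemma treeset_stays f r : acyc f -> stays f (treeset f r).
Proof. by move=> af x y; rewrite !inE => /eqP <- fx; rewrite (rootof_step af fx). Qed.

Lemma treeset_noenter f r : acyc f -> noenter f (treeset f r).
Proof. by move=> af x y; rewrite !inE => xr fx; rewrite -(rootof_step af fx). Qed.

Lemma roots_treeset f r : acyc f -> f r = None -> rootset f :&: treeset f r = [set r].
Proof.
move=> af fr; apply/setP => x; rewrite !inE; apply/andP/eqP => [[/eqP fx]|->].
  by rewrite rootof_stop // => /eqP.
by rewrite fr rootof_stop.
Qed.

(** Pigeonhole: the map taking each root of [g] to its root in [f] cannot hit all roots of [f]. *)
Lemma root_free_tree f g : #|rootset g| < #|rootset f| -> acyc f ->
  exists r, f r = None /\ [disjoint rootset g & treeset f r].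
Proof.
move=> lt af; have [/subsetP sub|] := boolP (rootset f \subset rootof f @: rootset g).
  by move: lt; rewrite ltnNge (leq_trans (subset_leq_card (introT subsetP sub))) ?leq_imset_card.
case/subsetPn => r; rewrite inE => /eqP fr nr; exists r; split=> //.
apply/pred0P => x /=; apply/negP => /andP [gx]; rewrite inE => /eqP xr.
by move/negP: nr; apply; apply/imsetP; exists x.
Qed.

(** The tree contains one root of [f] and none of [g], so the exchange moves exactly one root from
    [f] to [g]. *)
Lemma swap_card f g r : acyc f -> f r = None -> [disjoint rootset g & treeset f r] ->
  #|rootset (mix (treeset f r) f g)| = #|rootset g|.+1 /\
  #|rootset (mix (treeset f r) g f)|.+1 = #|rootset f|.
Proof.
move=> af fr dis; rewrite !card_roots_mix roots_treeset // cards1.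
have -> : rootset g :&: treeset f r = set0 by apply/eqP; rewrite setI_eq0.
rewrite cards0; split.
  rewrite -[in RHS](cardsID (treeset f r) (rootset g)).
  suff -> : rootset g :&: treeset f r = set0 by rewrite cards0.
  by apply/eqP; rewrite setI_eq0.
by rewrite -(cardsID (treeset f r) (rootset f)) roots_treeset // cards1.
Qed.

End FunctionalForests.

(** * Optimal forests and inseparable vertices *)
Section OptimalForests.
Variables (R : realFieldType) (T : finType).
Variables (w : T -> option T -> R) (ok : T -> option T -> bool).
Implicit Types (f g h A B H K : {ffun T -> option T}) (S P U E : {set T}) (x y z r : T).

Definition cost P f : R := (\sum_(x in P) w x (f x))%R.

Definition forest f := acyc f && [forall x, ok x (f x)].

Definition opt f :=
  forest f && [forall g, forest g ==> (cost setT f <= cost setT g)%R].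

Definition flat S := forall f g, opt f -> opt g -> cost S f = cost S g.

Definition insep x y := [forall f, opt f ==> (rootof f x == rootof f y)].

Definition solid S :=
  forall f x y, opt f -> x \in S -> y \in S -> term S f x = term S f y.

Lemma opt_forest f : opt f -> forest f. Proof. by case/andP. Qed.

Lemma opt_acyc f : opt f -> acyc f. Proof. by case/andP => /andP []. Qed.

Lemma opt_le f g : opt f -> forest g -> (cost setT f <= cost setT g)%R.
Proof. by case/andP => _ /forallP /(_ g) /implyP. Qed.

Lemma forest_mix P f g : forest f -> forest g -> acyc (mix P f g) -> forest (mix P f g).
Proof.
case/andP => _ /forallP vf /andP [_ /forallP vg] am; apply/andP; split=> //.
by apply/forallP => x; rewrite ffunE; case: ifP.
Qed.

Lemma cost_split P f : cost setT f = (cost P f + cost (~: P) f)%R.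
Proof.
rewrite /cost (bigID (mem P)) /=.
by congr (_ + _)%R; apply: eq_bigl => x; rewrite !inE.
Qed.

Lemma cost_mix P f g : cost setT (mix P f g) = (cost P f + cost (~: P) g)%R.
Proof.
rewrite (cost_split P); congr (_ + _)%R; apply: eq_bigr => x.
  by move=> xP; rewrite mixT.
by rewrite inE => xP; rewrite mixN.
Qed.

Lemma cost_eqin P f g : {in P, f =1 g} -> cost P f = cost P g.
Proof. by move=> eqfg; apply: eq_bigr => x xP; rewrite eqfg. Qed.

Lemma opt_mix_le P f g : opt g -> forest f -> acyc (mix P f g) ->
  (cost P g <= cost P f)%R.
Proof.
move=> og ff am; have := opt_le og (forest_mix ff (opt_forest og) am).
by rewrite cost_mix (cost_split P) lerD2r.
Qed.

Lemma exchange P f g : opt f -> opt g -> acyc (mix P f g) -> acyc (mix P g f) ->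
  cost P f = cost P g.
Proof.
move=> of_ og a1 a2; apply/le_anti.
by rewrite !opt_mix_le // ?opt_forest.
Qed.

Lemma opt_mix P f g : opt f -> opt g -> cost P f = cost P g -> acyc (mix P f g) ->
  opt (mix P f g).
Proof.
move=> of_ og eqc am; apply/andP; split; first by apply: forest_mix; rewrite ?opt_forest.
apply/forallP => h; apply/implyP => fh; rewrite cost_mix eqc -cost_split.
exact: opt_le.
Qed.

Lemma saturated_flat f S : opt f -> stays f S -> noenter f S -> flat S.
Proof.
move=> of_ st ne; suff H g : opt g -> cost S f = cost S g.
  by move=> g h /H <- /H <-.
move=> og; have af := opt_acyc of_; have ag := opt_acyc og.
by apply: exchange => //; [apply: mix_acyc_stays|apply: mix_acyc_noenter].
Qed.

Lemma treeset_flat f r : opt f -> flat (treeset f r).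
Proof.
move=> of_; have af := opt_acyc of_.
by apply: (saturated_flat of_); [apply: treeset_stays|apply: treeset_noenter].
Qed.

Lemma opt_mix_noenter S f g : flat S -> opt f -> opt g -> noenter g S ->
  opt (mix S f g).
Proof.
move=> fl of_ og ne; apply: opt_mix => //; first exact: fl.
by apply: mix_acyc_noenter; rewrite ?opt_acyc.
Qed.

(** Here [P] is a union of components of [f] restricted to [S]. It can be exchanged on its own: a
    path of [f] leaves [P] only by leaving [S], and [A] does not come back. *)
Lemma local_exchange S A f P : flat S -> opt A -> noenter A S -> opt f ->
  P \subset S ->
  (forall x y, x \in S -> y \in S -> f x = Some y -> (x \in P) = (y \in P)) ->
  cost P f = cost P A /\ opt (mix P f A).
Proof.
move=> fl oA ne of_ /subsetP sPS sat.
have aA := opt_acyc oA; have af := opt_acyc of_.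
have acm : acyc (mix P f A).
  apply: (@mix_acyc _ P (~: S)) => //.
  - apply/pred0P => x /=; rewrite inE; apply/negP => /andP [/negP xS /sPS //].
  - exact/noenterC.
  - move=> x y xP fx; rewrite !inE; case: (boolP (y \in S)) => yS; last by rewrite orbT.
    by rewrite -(sat _ _ (sPS _ xP) yS fx) xP.
have oB := opt_mix_noenter fl of_ oA ne.
have eqB : {in P, mix S f A =1 f} by move=> x /sPS; apply: mixT.
suff eqc : cost P f = cost P A by split=> //; apply: opt_mix.
(* On [P], [f] is replaced by the optimal [mix S f A], which follows [A] outside [S]; this makes the
   reverse exchange acyclic. *)
rewrite -(cost_eqin eqB); apply: exchange => //.
  have -> : mix P (mix S f A) A = mix P f A; last exact: acm.
  apply/ffunP => x; case: (boolP (x \in P)) => xP; last by rewrite !mixN.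
  by rewrite mixT // eqB // mixT.
rewrite -mixC; apply: mix_acyc_stays => //; first exact: opt_acyc.
move=> x y; rewrite !inE => xP; rewrite ffunE; case: ifPn => [xS fx|xS fx].
  case: (boolP (y \in S)) => yS; last by apply: contra yS; apply: sPS.
  by rewrite -(sat _ _ xS yS fx).
by have := ne _ _ xS fx; apply: contra; apply: sPS.
Qed.

Lemma insepP x y : reflect (forall f, opt f -> rootof f x = rootof f y) (insep x y).
Proof.
apply: (iffP forallP) => [H f of_|H f]; last by apply/implyP => /H ->.
by have /implyP /(_ of_) /eqP := H f.
Qed.

Lemma insep_refl x : insep x x. Proof. by apply/insepP. Qed.

Lemma insep_sym x y : insep x y = insep y x.
Proof. by apply/insepP/insepP => H f /H. Qed.

Lemma insep_trans y x z : insep x y -> insep y z -> insep x z.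
Proof. by move=> /insepP xy /insepP yz; apply/insepP => f of_; rewrite xy // yz. Qed.

(* [A] and [B] witness that some optimal forest modified inside [S] alone can
   send all of [S] to the tree of [r] or keep all of [S] out of it. *)
Record switch S A B r : Prop := Switch {
  switch_opt1 : opt A;
  switch_opt2 : opt B;
  switch_flat : flat S;
  switch_noenter : noenter A S;
  switch_eq : forall x, x \notin S -> B x = A x;
  switch_on : forall x, x \in S -> rootof A x = r;
  switch_off : forall x, x \in S -> rootof B x != r }.

Section Part.
Variables (S : {set T}) (H : {ffun T -> option T}) (Q : pred T).
Hypotheses (flS : flat S) (oH : opt H) (neH : noenter H S).

Definition part := [set x in S | Q (rootof H x)].

Lemma part_sub : part \subset S.
Proof. by apply/subsetP => x; rewrite inE => /andP []. Qed.

Lemma part_noenter : noenter H part.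
Proof.
move=> x y xp Hx; apply: contra xp; rewrite !inE => /andP [yS Qy].
rewrite (rootof_step (opt_acyc oH) Hx) Qy andbT.
by apply: contraLR yS => xS; apply: neH Hx.
Qed.

(** Transplanting [F] into [S] on top of [H] gives an optimal forest that does not enter [S] from
    outside. It is compared with [H] on [part], a union of components of [H] restricted to [S]. *)
Lemma part_flat : flat part.
Proof.
suff eqc F : opt F -> cost part H = cost part F by move=> f g /eqc <- /eqc <-.
move=> oF.
have oB := opt_mix_noenter flS oF oH neH.
have neB : noenter (mix S F H) S by move=> x y xS; rewrite mixN //; apply: neH.
have [|-> _] := local_exchange flS oB neB oH part_sub.
  by move=> x y xS yS Hx; rewrite !inE xS yS (rootof_step (opt_acyc oH) Hx).
by apply: cost_eqin => x; rewrite inE => /andP [xS _]; rewrite mixT.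
Qed.

Lemma part_opt f : opt f -> opt (mix part f H).
Proof. by move=> of_; apply: opt_mix_noenter part_flat of_ oH part_noenter. Qed.

Lemma rootof_mix_noenter f P x : acyc f -> noenter H P -> x \notin P ->
  rootof (mix P f H) x = rootof H x.
Proof.
move=> af ne xP; have aH := opt_acyc oH.
apply: (@rootof_eqin _ _ _ (~: P)) => //; first exact: mix_acyc_noenter.
- by apply/noenterC => y z yP; rewrite mixN //; apply: ne.
- by move=> y; rewrite inE => yP; rewrite mixN.
- by rewrite inE.
Qed.

(* [f] leaves [part] towards vertices that [H] sends to a root not in [Q]. *)
Lemma rootof_part f x : opt f -> (forall y, y \notin S -> f y = H y) ->
  (forall y, y \in S -> ~~ Q (rootof f y)) ->
  x \in part -> ~~ Q (rootof (mix part f H) x).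
Proof.
move=> of_ eqf Qf xp; have af := opt_acyc of_; have aH := opt_acyc oH.
have aK := opt_acyc (part_opt of_).
elim/(acyc_ind aK): x xp => x IH xp; have xS := subsetP part_sub _ xp.
case Kx: (mix part f H x) => [y|]; have fx := Kx; rewrite mixT // in fx; last first.
  by rewrite rootof_stop // -(rootof_stop fx) Qf.
rewrite (rootof_step aK Kx); have [|yp] := boolP (y \in part); first exact: IH.
rewrite rootof_mix_noenter //; last exact: part_noenter.
have [yS|yS] := boolP (y \in S); first by move: yp; rewrite inE yS.
rewrite -(@rootof_eqin _ f H (~: S)) ?inE // -?(rootof_step af fx) ?Qf //.
  by apply/noenterC => a b aS; rewrite eqf //; apply: neH.
by move=> z; rewrite inE; apply: eqf.
Qed.

End Part.

Definition constant_on S H r :=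
  (forall x, x \in S -> rootof H x = r) \/ (forall x, x \in S -> rootof H x != r).

(** Constancy forces one vertex [t] into every component of [F] restricted to [S]: a component
    missing [t] could be combined with a forest that treats [t] the other way. *)
Lemma switch_solid S A B r x0 : switch S A B r -> x0 \in S ->
  (forall H, opt H -> (forall x, x \notin S -> H x = A x) -> constant_on S H r) ->
  solid S.
Proof.
move=> [oA oB fl neA eqB onA offB] x0S cst F.
have neB : noenter B S by move=> x y xS; rewrite eqB //; apply: neA.
have aA := opt_acyc oA; have aB := opt_acyc oB.
suff hub : opt F -> exists t, forall x, x \in S -> term S F t = term S F x.
  by move=> x y /hub [t Ht] xS yS; rewrite -!Ht.
move=> oF; have aF := opt_acyc oF; set H := mix S F A.
have oH : opt H by apply: opt_mix_noenter.
have aH := opt_acyc oH.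
(* [X] is the one of [A] and [B] whose behaviour on [S] with regard to [r] is opposite to that of
   [H]. *)
have [X [oX neX eqX negX]] : exists X, [/\ opt X, noenter X S,
    (forall x, x \notin S -> X x = A x) &
    forall x y, x \in S -> y \in S -> (rootof H x == r) != (rootof X y == r)].
  have [on|off] := cst H oH (fun x => @mixN _ S F A x).
    exists B; split=> // x y xS yS; by rewrite on // eqxx (negbTE (offB _ yS)).
  exists A; split=> // x y xS yS; by rewrite onA // eqxx (negbTE (off _ xS)).
have aX := opt_acyc oX; set t := term S X x0; exists t => x xS.
have tS : t \in S by apply: term_in.
pose P := [set z in S | term S F z == term S F x].
have sPS : P \subset S by apply/subsetP => z; rewrite inE => /andP [].
suff : t \in P by rewrite inE => /andP [_ /eqP].
have [|_ oK] := local_exchange fl oX neX oF sPS.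
  by move=> a b aS bS Fa; rewrite !inE aS bS (term_step aF aS bS Fa).
have aK := opt_acyc oK; set K := mix P F X in oK aK *.
have eqK z : z \notin S -> K z = A z.
  by move=> zS; rewrite mixN ?eqX //; apply: contra zS; apply: (subsetP sPS).
have off_S Y Z z : opt Y -> opt Z -> (forall z, z \notin S -> Y z = A z) ->
    (forall z, z \notin S -> Z z = A z) -> z \notin S -> rootof Y z = rootof Z z.
  move=> oY oZ eY eZ zS; apply: (@rootof_eqin _ Y Z (~: S)); rewrite ?inE ?opt_acyc //.
    by apply/noenterC => a b aS; rewrite eY //; apply: neA.
  by move=> a; rewrite inE => aS; rewrite eY // eZ.
have KP z : z \in P -> rootof K z = rootof H z.
  elim/(acyc_ind aF): z => z IH zP; have zS := subsetP sPS _ zP.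
  case Fz: (F z) => [y|]; have Kz := Fz; have Hz := Fz;
    rewrite -(mixT F X zP) -/K in Kz; rewrite -(mixT F A zS) -/H in Hz; last first.
    by rewrite !rootof_stop.
  rewrite (rootof_step aK Kz) (rootof_step aH Hz); have [yS|yS] := boolP (y \in S).
    apply: IH => //; move: zP; rewrite !inE zS yS /= => /eqP <-.
    by rewrite (term_step aF zS yS Fz).
  by apply: off_S => // a; apply: mixN.
(* If [t] were outside [P], [K] would stop at [t] or leave [S] from there as [X] does, while from
   [x] it ends as [H] does; so [K] would not be constant on [S]. *)
apply: contraT => tP; have Kt := mixN F X tP; rewrite -/K in Kt.
have rKt : rootof K t = rootof X t.
  case Xt: (X t) => [y|]; rewrite Xt in Kt; last by rewrite !rootof_stop.
  rewrite (rootof_step aK Kt) (rootof_step aX Xt); apply: off_S => //.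
  by apply: term_exit Xt.
have xP : x \in P by rewrite inE xS /=.
have /negP [] := negX _ _ xS tS; rewrite -rKt -KP //.
by have [c|c] := cst K oK eqK; rewrite ?c // (negbTE (c _ xS)) (negbTE (c _ tS)).
Qed.

(** [H] sends all of [E] to one root, so [E] lies on one side of the split of [S] by [H]; both sides
    being nonempty, that side is smaller than [S]. *)
Lemma switch_shrink S A B r H E e : switch S A B r -> opt H ->
  (forall x, x \notin S -> H x = A x) -> E \subset S -> e \in E ->
  {in E, forall x, insep e x} -> ~ constant_on S H r ->
  exists S' A' B', [/\ switch S' A' B' r, E \subset S' & #|S'| < #|S|].
Proof.
move=> [oA oB fl neA eqB onA offB] oH eqH sES eE inE_ ncst.
have neH : noenter H S by move=> x y xS; rewrite eqH //; apply: neA.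
have sub (Q : pred T) : Q (rootof H e) -> E \subset part S H Q.
  move=> Qe; apply/subsetP => x xE; rewrite inE (subsetP sES) //=.
  by have /insepP /(_ _ oH) <- := inE_ _ xE.
have ltS (Q : pred T) y : y \in S -> ~~ Q (rootof H y) -> #|part S H Q| < #|S|.
  move=> yS Qy; apply: proper_card; apply/properP; split; first exact: part_sub.
  by exists y => //; rewrite inE yS.
(* On the side sent to [r], [H] sends everything to [r] and [B] used there avoids it. On the other
   side, [A] used there sends everything to [r] and [H] avoids it. *)
have [er|er] := boolP (rootof H e == r).
  pose Q z := z == r; exists (part S H Q), H, (mix (part S H Q) B H); split.
  - split=> //; [exact: part_opt|exact: part_flat|exact: part_noenter| | |].
    + by move=> x xp; rewrite mixN.
    + by move=> x; rewrite inE => /andP [_ /eqP].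
    + by move=> x xp; apply: (@rootof_part S H Q) => // y yS; rewrite eqB // eqH.
  - exact: sub.
  - have [/forall_inP all|] := boolP [forall x in S, rootof H x == r].
      by case: ncst; left => x /all /eqP.
    by case/forall_inPn => y yS yr; apply: (ltS _ y).
pose Q z := z != r; exists (part S H Q), (mix (part S H Q) A H), H; split.
- split=> //; [exact: part_opt|exact: part_flat| | | |].
  + by move=> x y xp; rewrite mixN //; apply: part_noenter.
  + by move=> x xp; rewrite mixN.
  + move=> x xp; apply/eqP; rewrite -[_ == _]negbK; apply: (@rootof_part S H Q) => // y yS.
      by rewrite eqH.
    by rewrite negbK onA.
  + by move=> x; rewrite inE => /andP [].
- exact: sub.
- have [/forall_inP all|] := boolP [forall x in S, rootof H x != r].
    by case: ncst; right => x /all.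
  by case/forall_inPn => y yS yr; apply: (ltS _ y).
Qed.

Lemma switch_hull S A B r E e : switch S A B r -> E \subset S -> e \in E ->
  {in E, forall x, insep e x} -> exists S', [/\ solid S', flat S' & E \subset S'].
Proof.
have [n] := ubnP #|S|; elim: n S A B => // n IH S A B; rewrite ltnS => Sn sw sES eE inE_.
pose cstb H := [forall x in S, rootof H x == r] || [forall x in S, rootof H x != r].
have cstP H : reflect (constant_on S H r) (cstb H).
  apply: (iffP orP) => -[h|h]; [left|right|left|right].
  - by move=> x xS; have /forall_inP /(_ x xS) /eqP := h.
  - by move=> x xS; have /forall_inP := h; apply.
  - by apply/forall_inP => x /h ->.
  - by apply/forall_inP => x /h.
have [/existsP [H /and3P [oH /forall_inP eqH ncst]]|/existsPn no] :=
  boolP [exists H, [&& opt H, [forall x in ~: S, H x == A x] & ~~ cstb H]].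
  have [|S' [A' [B' [sw' sES' lt]]]] := switch_shrink sw oH _ sES eE inE_ (elimN (cstP H) ncst).
    by move=> x xS; apply/eqP/eqH; rewrite inE.
  exact: IH (leq_trans lt Sn) sw' sES' eE inE_.
exists S; split=> //; last exact: switch_flat sw.
apply: (switch_solid sw (subsetP sES _ eE)) => H oH eqH; apply/cstP.
have := no H; rewrite oH /= negb_and negbK => /orP [/forall_inPn [x]|//].
by rewrite inE => /eqH ->; rewrite eqxx.
Qed.

(** A smallest tree containing [E] is taken over all optimal forests. Either no exchange inside it
    frees a vertex from its root, and it is solid, or such an exchange supplies a first switch. *)
Lemma insep_hull E e : (exists G, opt G) -> e \in E -> {in E, forall x, insep e x} ->
  exists S, [/\ solid S, flat S & E \subset S].
Proof.
move=> [G oG] eE inE_.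
have subG K : opt K -> E \subset treeset K (rootof K e).
  move=> oK; apply/subsetP => x xE; rewrite inE.
  by have /insepP /(_ _ oK) -> := inE_ _ xE.
case: (@arg_minnP _ G opt (fun K => #|treeset K (rootof K e)|) oG) => {oG}{}G oG minG.
have aG := opt_acyc oG; set g := rootof G e in minG *; set S := treeset G g in minG *.
have sES : E \subset S := subG _ oG.
have fl : flat S by apply: treeset_flat.
have ne : noenter G S by apply: treeset_noenter.
have gG : G g = None by apply: rootof_none.
have gS : g \in S by rewrite inE rootof_stop.
pose on F := [forall x in S, rootof (mix S F G) x == g].
have [/forallP alls|] := boolP [forall F, opt F ==> on F].
  exists S; split=> // F x y oF xS yS; have aF := opt_acyc oF.
  have oH := opt_mix_noenter fl oF oG ne; have aH := opt_acyc oH.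
  have /forall_inP onF := implyP (alls F) oF.
  (* A departure from [S] at [term S F z] would end outside the tree of [g], so this vertex must be
     [g] itself. *)
  suff tg z : z \in S -> term S F z = g by rewrite !tg.
  move=> zS; set t := term S F z; have tS : t \in S by apply: term_in.
  have /eqP rt := onF _ tS; case Ft: (F t) => [b|]; last first.
    by rewrite -rt rootof_stop // mixT.
  have bS := term_exit aF zS Ft.
  have Ht : mix S F G t = Some b by rewrite mixT.
  move: rt bS; rewrite (rootof_step aH Ht) => rb bS.
  rewrite (rootof_mix_noenter oG aF ne bS) in rb.
  by move: bS; rewrite inE rb eqxx.
rewrite negb_forall => /existsP [F]; rewrite negb_imply => /andP [oF].
case/forall_inPn => x0 x0S x0g; have aF := opt_acyc oF.
set H := mix S F G in x0g; have oH : opt H := opt_mix_noenter fl oF oG ne.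
have neH : noenter H S by move=> x y xS; rewrite mixN //; apply: ne.
have outS x : x \notin S -> rootof H x \notin S.
  move=> xS; rewrite (rootof_mix_noenter oG aF ne xS).
  by rewrite inE rootof_stop ?rootof_none //; move: xS; rewrite inE.
(* If [e] kept the root [g], the tree of [g] in [H] would lose [x0] and gain nothing, against
   minimality. *)
have [eg|eg] := eqVneq (rootof H e) g.
  have := minG _ oH; rewrite eg leqNgt => /negP []; apply: proper_card.
  apply/properP; split; last by exists x0 => //; rewrite inE.
  apply/subsetP => x; rewrite [x \in _]inE => /eqP xg.
  by apply: contraT => /outS; rewrite xg gS.
pose Q z := z != g; set S' := part S H Q.
have sub' : S' \subset S := part_sub _ _ _.
have sES' : E \subset S'.
  apply/subsetP => x xE; rewrite inE (subsetP sES) //=.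
  by have /insepP /(_ _ oH) <- := inE_ _ xE.
apply: (@switch_hull S' (mix S' G H) H g E e) => //; split=> //.
- exact: part_opt.
- exact: part_flat.
- by move=> x y xp; rewrite mixN //; apply: part_noenter.
- by move=> x xp; rewrite mixN.
- move=> x xp; apply/eqP; rewrite -[_ == _]negbK; apply: (@rootof_part S H Q) => //.
    by move=> y yS; rewrite mixN.
  by move=> y; rewrite inE negbK => /eqP ->.
- by move=> x; rewrite inE => /andP [].
Qed.

(** These inseparability classes will turn out to be the atoms. *)
Definition cls x := [set y | insep x y].

(** The hull of a class is the class itself: in a solid set, a common last vertex gives a common
    root in each optimal forest. *)
Lemma cls_solid_flat x : (exists G, opt G) -> solid (cls x) /\ flat (cls x).
Proof.
move=> exG; have xx : x \in cls x by rewrite inE insep_refl.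
have [|S [so fl sub]] := insep_hull exG xx; first by move=> y; rewrite inE.
suff -> : cls x = S by [].
apply/eqP; rewrite eqEsubset sub; apply/subsetP => y yS; rewrite inE.
have xS := subsetP sub _ xx; apply/insepP => f of_; have af := opt_acyc of_.
by rewrite -(rootof_term af xS) -(rootof_term af yS) (so f x y).
Qed.

End OptimalForests.

(** * The number of roots of a separating optimal forest *)
Section RootCount.
Variables (R : realFieldType) (T : finType).
Variables (w : T -> option T -> R) (ok : T -> option T -> bool).
Implicit Types (f g h G H K : {ffun T -> option T}) (S P W : {set T}) (a b x y z r : T).

Notation opt := (opt w ok).
Notation insep := (insep w ok).
Notation cls := (cls w ok).
Notation cost := (cost w).

(* A smallest tree [S] without roots of [H], over all optimal forests, is left
   by [H] through a single vertex; making [S] a tree of its own separates no less. *)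
Lemma separate_more_roots H G u v : opt H -> opt G -> #|rootset H| < #|rootset G| ->
  rootof H u != rootof H v ->
  exists K, [/\ opt K, #|rootset K| = #|rootset H|.+1 & rootof K u != rootof K v].
Proof.
move=> oH oG0 lt suv; have aH := opt_acyc oH.
have [g0 [G0g dis0]] := root_free_tree lt (opt_acyc oG0).
pose ok2 (p : {ffun T -> option T} * T) :=
  [&& opt p.1, p.1 p.2 == None & [disjoint rootset H & treeset p.1 p.2]].
have ok0 : ok2 (G, g0) by rewrite /ok2 oG0 G0g dis0.
case: (arg_minnP (fun p => #|treeset p.1 p.2|) ok0) => -[{oG0 lt ok0 G0g dis0 g0}{}G g].
rewrite /ok2 /= => /and3P [oG /eqP Gg dis] minG; set S := treeset G g in dis minG.
have aG := opt_acyc oG.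
have fl : flat w ok S by apply: treeset_flat.
have ne : noenter G S by apply: treeset_noenter.
have st : stays G S by apply: treeset_stays.
have gS : g \in S by rewrite inE rootof_stop.
have HS x : x \in S -> H x != None.
  by move=> xS; move: (disjointFl dis xS); rewrite inE => ->.
(* [P] collects the vertices whose path in [H] leaves [S] elsewhere than the path from [g]. If it
   were nonempty, exchanging it would leave [g] with a smaller tree free of roots of [H]. *)
pose P := [set x in S | term S H x != term S H g].
have inP x : (x \in P) = (x \in S) && (term S H x != term S H g) by rewrite [LHS]inE.
have sPS : P \subset S by apply/subsetP => x; rewrite inP => /andP [].
have [|_ oK] := local_exchange fl oG ne oH sPS.
  by move=> x y xS yS Hx; rewrite !inP xS yS (term_step aH xS yS Hx).
have aK := opt_acyc oK; set K := mix P H G in oK aK.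
have KS x : x \notin S -> rootof K x \notin S.
  move=> xS.
  have eqK y : y \notin S -> K y = G y.
    by move=> yS; rewrite mixN //; apply: contra yS; apply: (subsetP sPS).
  have stK : stays K (~: S).
    by apply/noenterC => y z yS; rewrite eqK //; apply: ne.
  by rewrite -in_setC; apply: rootof_stays; rewrite // in_setC.
have PK x : x \in P -> rootof K x \notin S.
  elim/(acyc_ind aK): x => x IH xP; have xS := subsetP sPS _ xP.
  have := HS _ xS; case Hx: (H x) => [y|//] _.
  have Kx : K x = Some y by rewrite /K mixT.
  rewrite (rootof_step aK Kx); have [yS|] := boolP (y \in S); last exact: KS.
  apply: IH => //; move: xP; rewrite !inP xS yS /=.
  by rewrite (term_step aH xS yS Hx).
have gP : g \notin P by rewrite inP eqxx andbF.
have Kg : K g = None by rewrite /K mixN.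
have subK : treeset K g \subset S :\: P.
  apply/subsetP => x; rewrite [x \in treeset _ _]inE => /eqP xg; rewrite inE.
  apply/andP; split; first by apply: contraL gS => /PK; rewrite xg.
  by apply: contraLR gS => /KS; rewrite xg.
have eqT x : x \in S -> term S H x = term S H g.
  move=> xS; apply/eqP; apply: contraT => xg; have xP : x \in P by rewrite inP xS.
  have : ok2 (K, g).
    rewrite /ok2 /= oK Kg /=; apply: disjointWr dis.
    by apply: subset_trans subK _; rewrite subsetDl.
  move/minG => /=; rewrite leqNgt => /negP []; apply: proper_card.
  apply: sub_proper_trans subK _; apply/properP; split; first exact: subsetDl.
  by exists x; rewrite // inE xP.
set M := mix S G H.
have oM : opt M by apply: opt_mix => //; [apply: fl|apply: mix_acyc_stays].
have aM := opt_acyc oM.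
exists M; split=> //; first by have [] := swap_card aG Gg dis.
set t := term S H g in eqT.
have MS x : x \in S -> rootof M x = g.
  move=> xS; rewrite (@rootof_eqin _ M G S) //.
  - by move: xS; rewrite inE => /eqP.
  - by move=> y z yS; rewrite mixT //; apply: st.
  - by move=> y yS; rewrite /M mixT.
(* As vertex sets, the trees of [H] arise from those of [M] by merging the tree of [g] into that of
   [t], so a common root in [M] implies one in [H]. *)
have dich x : (rootof M x = g /\ rootof H x = rootof H t) \/
              (rootof M x != g /\ rootof H x = rootof M x).
  elim/(acyc_ind aH): x => x IH; have [xS|xS] := boolP (x \in S).
    by left; rewrite MS // -(eqT _ xS) rootof_term.
  have eqx : M x = H x by rewrite /M mixN.
  case Hx: (H x) => [y|]; rewrite Hx in eqx.
    by rewrite (rootof_step aM eqx) (rootof_step aH Hx); apply: IH.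
  right; rewrite !rootof_stop //; split=> //.
  by apply: contraNneq xS => ->.
apply: contraNneq suv => Muv.
have [[ug ->]|[ug ->]] := dich u; have [[vg ->]|[vg ->]] := dich v => //.
- by move: vg; rewrite -Muv ug eqxx.
- by move: ug; rewrite Muv vg eqxx.
- by rewrite Muv.
Qed.

Lemma cls_saturated_flat W : (exists G, opt G) ->
  (forall x y, x \in W -> insep x y -> y \in W) -> flat w ok W.
Proof.
move=> exG sat f g of_ og; rewrite /cost !(partition_big cls predT) //=.
apply: eq_bigr => C _.
have [/existsP [x /andP [xW /eqP xC]]|/existsPn no] :=
  boolP [exists x, (x \in W) && (cls x == C)]; last first.
  by rewrite !big_pred0 // => x; apply/negbTE/no.
have eqC y : ((y \in W) && (cls y == C)) = (y \in cls x).
  rewrite -xC inE; apply/andP/idP => [[yW /eqP eqy]|xy].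
    by have := insep_refl w ok y; rewrite -[insep y y]inE -/(cls y) eqy inE.
  split; first exact: sat xW xy.
  apply/eqP/setP => z; rewrite !inE; apply/idP/idP => yz.
    exact: insep_trans xy yz.
  by apply: insep_trans yz; rewrite insep_sym.
rewrite !(eq_bigl _ _ eqC).
exact: (proj2 (cls_solid_flat x exG)).
Qed.

(** * Trails: paths enlarged to whole inseparability classes, on which costs are the same in all
    optimal forests *)

Definition trail H a := [set y | [exists z, reach H a z && insep z y]].

Lemma trailP H a y : reflect (exists2 z, reach H a z & insep z y) (y \in trail H a).
Proof.
rewrite inE; apply: (iffP existsP) => [[z /andP []]|[z]]; first by exists z.
by move=> az zy; exists z; rewrite az.
Qed.

Lemma trail_reach H a z : reach H a z -> z \in trail H a.
Proof. by move=> az; apply/trailP; exists z => //; apply: insep_refl. Qed.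

Lemma trail_sat H a x y : x \in trail H a -> insep x y -> y \in trail H a.
Proof. by move=> /trailP [z az zx] xy; apply/trailP; exists z => //; apply: insep_trans xy. Qed.

Lemma trail_rootof H a y : opt H -> y \in trail H a -> rootof H y = rootof H a.
Proof.
move=> oH /trailP [z az /insepP zy]; rewrite -(zy _ oH).
by rewrite (rootof_reach (opt_acyc oH) az).
Qed.

(* By solidity, inseparable vertices leave their class through the same vertex. *)
Lemma insep_reach H x y z : opt H -> insep x y -> reach H x z -> ~~ insep x z ->
  reach H y z.
Proof.
move=> oH xy xz nxz; have aH := opt_acyc oH.
have [so _] := cls_solid_flat x (ex_intro _ H oH).
have xx : x \in cls x by rewrite inE insep_refl.
have yx : y \in cls x by rewrite inE.
have [|tz] := reach_through_term aH xx xz; first by rewrite inE (negbTE nxz).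
by apply: reach_trans (reach_term aH yx) _; rewrite (so H y x).
Qed.

(** The head of an arc of [H] out of a class is reached from every vertex of that class, in
    particular from one on the path from [a]. *)
Lemma trail_stays H a : opt H -> stays H (trail H a).
Proof.
move=> oH x y xt Hx; have [xy|nxy] := boolP (insep x y); first exact: trail_sat xt xy.
have /trailP [z az zx] := xt.
apply: trail_reach; apply: reach_trans az _.
apply: (insep_reach oH) nxy; last exact: reach_step Hx (reach_refl _ _).
by rewrite insep_sym.
Qed.

(* The new forest sends [b] along its trail in [H], and [a] along its trail in
   [H] up to the class of [x]; from there [G] leaves [S] without meeting either
   trail.  The root [rootof H a] is lost, and no other root appears. *)
Section Reroute.
Variables (H G : {ffun T -> option T}) (a b x : T).
Hypotheses (oH : opt H) (oG : opt G) (sab : rootof H a != rootof H b).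
Let S := [set z | (rootof H z == rootof H a) || (rootof H z == rootof H b)].
Hypotheses (GH : forall z, z \notin S -> G z = H z)
  (GS : forall z, z \in S -> G z != None).
Hypotheses (xa : x \in trail H a)
  (xtail : forall y z, G x = Some y -> reach G y z ->
    z \notin trail H a :|: trail H b).

(** The trail of [a] strictly before the class of [x]; with the trail of [b] it forms the set [W] on
    which [H] is kept. *)
Let before := [set y in trail H a |
  ~~ insep x y & [exists z, reach H y z && insep x z]].
Let W := trail H b :|: before.
Let U := [set y | [forall z, reach G y z ==> (z \notin W)]].

Let aH : acyc H := opt_acyc oH.
Let aG : acyc G := opt_acyc oG.

Let trail_disj z : z \in trail H a -> z \notin trail H b.
Proof.
by move=> za; apply: contraNN sab => zb; rewrite -(trail_rootof oH za) (trail_rootof oH zb).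
Qed.

Let W_trail z : z \in W -> z \in trail H a :|: trail H b.
Proof. by rewrite !in_setU => /orP [->|]; rewrite ?orbT // inE => /andP [->]. Qed.

Let W_sub z : z \in W -> z \in S.
Proof.
move/W_trail; rewrite in_setU => /orP [] zt; rewrite inE (trail_rootof oH zt) eqxx //.
by rewrite orbT.
Qed.

Let cls_W z : insep x z -> z \notin W.
Proof.
move=> xz; rewrite in_setU negb_or; apply/andP; split.
  by apply: trail_disj; apply: trail_sat xa xz.
by rewrite inE xz andbF.
Qed.

(** A path of [G] out of the class of [x] continues as the path from [x] does, and beyond [x] that
    path avoids both trails. *)
Let cls_U y : insep x y -> y \in U.
Proof.
move=> xy; rewrite inE; apply/forallP => z; apply/implyP => yz.
have [/cls_W //|nxz] := boolP (insep x z).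
have yx : insep y x by rewrite insep_sym.
have nyz : ~~ insep y z by apply: contra nxz; apply: insep_trans.
case/reachP: (insep_reach oG yx yz nyz) => [xz|[t Gx tz]].
  by rewrite -xz insep_refl in nxz.
by apply: contra (xtail Gx tz); apply: W_trail.
Qed.

Let before_step y z : y \in before -> H y = Some z -> z \in before \/ insep x z.
Proof.
rewrite inE => /and3P [ya nxy /existsP [t /andP [yt xt]]] Hy.
have [|nxz] := boolP (insep x z); [by right|left].
rewrite inE (trail_stays oH ya Hy) nxz; apply/existsP; exists t; rewrite xt andbT.
case/reachP: yt => [yt|[z']]; first by rewrite yt xt in nxy.
by rewrite Hy => -[->].
Qed.

Let W_sat y z : y \in W -> insep y z -> z \in W.
Proof.
rewrite !in_setU => /orP [yb|yb] yz; first by rewrite (trail_sat yb yz).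
move: yb; rewrite inE => /and3P [ya nxy /existsP [t /andP [yt xt]]].
apply/orP; right; rewrite inE (trail_sat ya yz).
have -> /= : ~~ insep x z.
  by apply: contra nxy => xz; apply: insep_trans xz _; rewrite insep_sym.
apply/existsP; exists t; rewrite xt andbT.
apply: (insep_reach oH yz yt); apply: contra nxy => yt'.
by apply: insep_trans xt _; rewrite insep_sym.
Qed.

Let K := mix W H G.

Let U_W z : z \in U -> z \notin W.
Proof. by rewrite inE => /forallP /(_ z); rewrite reach_refl. Qed.

Let U_stays : stays G U.
Proof.
move=> y z; rewrite !inE => /forallP Uy Gy; apply/forallP => t; apply/implyP => zt.
by have := Uy t; rewrite (reach_step Gy zt).
Qed.

Let K_opt : opt K.
Proof.
apply: opt_mix => //; first by apply: cls_saturated_flat W_sat _ _ oH oG; exists H.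
apply: (@mix_acyc _ W U) => //.
  by apply/pred0P => z /=; apply/negP => /andP [/U_W /negP].
move=> y z; rewrite !in_setU => /orP [yb|yb] Hy.
  by rewrite (trail_stays oH yb Hy).
by have [->|/cls_U ->] := before_step yb Hy; rewrite !orbT.
Qed.

Let aK : acyc K := opt_acyc K_opt.

(** Roots of [K] inside [S] lie in [W], hence are roots of [H], since [G] has none in [S]; outside
    [S], [K] agrees with [H]. The root of [a] is in [S] but not in [W], so it is lost. *)
Lemma reroute_roots : #|rootset K| < #|rootset H|.
Proof.
apply: proper_card; apply/properP; split.
  apply/subsetP => z; rewrite !inE ffunE; case: ifPn => // zW.
  have [/GS|/GH ->] := boolP (z \in S); last by [].
  by move=> /negbTE ->.
exists (rootof H a); first by rewrite inE rootof_none.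
set r := rootof H a; have Hr : H r = None by apply: rootof_none.
have rr : rootof H r = r by apply: rootof_stop.
have rW : r \notin W.
  rewrite in_setU negb_or; apply/andP; split.
    by apply: contra sab => /(trail_rootof oH) <-; rewrite rr.
  rewrite inE; apply/and3P => -[_ nxr /existsP [z /andP [rz xz]]].
  by rewrite (reach_root Hr rz) in xz; rewrite xz in nxr.
by rewrite inE /K mixN // GS // inE rr eqxx.
Qed.

Let rootof_trail_b y : y \in trail H b -> rootof K y \in S.
Proof.
move=> yb; apply: W_sub; rewrite in_setU; apply/orP; left.
apply: rootof_stays aK _ yb => z t zb.
by rewrite /K mixT; [apply: trail_stays|rewrite in_setU zb].
Qed.

Let rootof_U y : y \in U -> rootof K y \notin S.
Proof.
move=> yU; have -> : rootof K y = rootof G y.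
  apply: (@rootof_eqin _ K G U) => // [z t zU|z zU]; last by rewrite /K mixN // U_W.
  by rewrite /K mixN ?U_W //; apply: U_stays.
by apply/negP => /GS; rewrite rootof_none.
Qed.

Let rootof_before y : y \in before -> rootof K y \notin S.
Proof.
elim/(acyc_ind aK): y => y IH yb.
have yW : y \in W by rewrite in_setU yb orbT.
case Hy: (H y) => [z|]; last first.
  move: yb; rewrite inE => /and3P [_ nxy /existsP [z /andP [yz xz]]].
  by rewrite (reach_root Hy yz) in xz; rewrite xz in nxy.
have Ky : K y = Some z by rewrite /K mixT.
rewrite (rootof_step aK Ky); have [|/cls_U] := before_step yb Hy; first exact: IH.
exact: rootof_U.
Qed.

(** In [K], [b] ends on its own trail, inside [S], while [a] reaches the class of [x] and from there
    ends outside [S]. *)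
Lemma reroute : exists K, [/\ opt K, #|rootset K| < #|rootset H| & rootof K a != rootof K b].
Proof.
exists K; split=> //; first exact: reroute_roots.
have bS := rootof_trail_b (trail_reach (reach_refl H b)).
suff : rootof K a \notin S by apply: contraNneq => ->.
have [/cls_U /rootof_U //|nxa] := boolP (insep x a); apply: rootof_before.
rewrite inE (trail_reach (reach_refl H a)) nxa.
by have /trailP [z az zx] := xa; apply/existsP; exists z; rewrite az insep_sym.
Qed.

End Reroute.

(** A tree of [H] without roots of [G] that contains neither [u] nor [v] is dissolved by an
    exchange. If there is none, the trees of [u] and [v] both lack roots of [G], and one of the two
    vertices is rerouted. *)
Lemma separate_fewer_roots H G u v : opt H -> opt G -> #|rootset G|.+1 < #|rootset H| ->
  rootof H u != rootof H v ->
  exists K, [/\ opt K, #|rootset K| < #|rootset H| & rootof K u != rootof K v].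
Proof.
move=> oH oG lt suv; have aH := opt_acyc oH; have aG := opt_acyc oG.
pose bad r := (H r == None) && [disjoint rootset G & treeset H r].
have [/existsP [r /and3P [/andP [/eqP Hr dis] ru rv]]|/existsPn no] :=
  boolP [exists r, [&& bad r, r != rootof H u & r != rootof H v]].
  set S := treeset H r in dis; exists (mix S G H).
  have ne : noenter H S by apply: treeset_noenter.
  split.
  - by apply: opt_mix_noenter => //; apply: treeset_flat.
  - by have [_ <-] := swap_card aH Hr dis.
  - by rewrite !(rootof_mix_noenter oH) // inE eq_sym.
have {}no r : bad r -> (r == rootof H u) || (r == rootof H v).
  by move=> br; have := no r; rewrite br /= negb_and !negbK.
(* Otherwise at most one tree of [H] would lack roots of [G], so [H] would have at most one root
   more than [G]. *)
have all_bad z : z \in [set rootof H u; rootof H v] -> bad z.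
  move=> zuv; apply: contraT => nbz; move: lt; rewrite ltnNge => /negP [].
  have [y sub] : exists y, rootset H \subset y |: rootof H @: rootset G.
    exists (if z == rootof H u then rootof H v else rootof H u).
    apply/subsetP => r; rewrite !inE => /eqP Hr; apply/orP.
    have [br|] := boolP (bad r).
      left; have := no _ br; have rz : r != z by apply: contraNneq nbz => <-.
      move: zuv; rewrite !inE; case: eqP => [<- _|_ /= /eqP <-]; rewrite (negbTE rz) //.
      by rewrite orbF.
    rewrite /bad Hr eqxx /= => /pred0Pn [t /= /andP [tG]]; rewrite inE => /eqP tr.
    by right; apply/imsetP; exists t.
  apply: leq_trans (subset_leq_card sub) _.
  apply: leq_trans (leq_card_setU _ _) _.
  by rewrite cards1 add1n ltnS leq_imset_card.
have dis r : r \in [set rootof H u; rootof H v] -> [disjoint rootset G & treeset H r].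
  by move/all_bad => /andP [].
pose S := [set z | rootof H z \in [set rootof H u; rootof H v]].
have neS : noenter H S by move=> y z; rewrite !inE => yS /(rootof_step aH) <-.
have stS : stays H S by move=> y z; rewrite !inE => yS /(rootof_step aH) <-.
have flS : flat w ok S by apply: (saturated_flat oH).
set G1 := mix S G H; have oG1 : opt G1 by apply: opt_mix_noenter.
have aG1 := opt_acyc oG1.
have G1H z : z \notin S -> G1 z = H z by apply: mixN.
have G1S z : z \in S -> G1 z != None.
  move=> zS; rewrite /G1 mixT //; move: (zS); rewrite inE => /dis dz.
  have zt : z \in treeset H (rootof H z) by rewrite inE.
  by move: (disjointFl dz zt); rewrite inE => ->.
have ut : u \in trail H u :|: trail H v by rewrite in_setU trail_reach ?reach_refl.
(* Past its last visit to the two trails the path of [G1] avoids both; the trail holding this last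
   vertex is the one to reroute. *)
have [x [ux xt tail]] := last_visit aG1 (reach_refl G1 u) ut.
move: xt; rewrite in_setU => /orP [xu|xv].
  by apply: (reroute oH oG1 suv _ _ xu tail) => z zS; [apply: G1H|apply: G1S];
    move: zS; rewrite !inE.
rewrite eq_sym in suv.
have [|||K [oK ltK sK]] := reroute oH oG1 suv _ _ xv _.
- by move=> z zS; apply: G1H; move: zS; rewrite !inE orbC.
- by move=> z zS; apply: G1S; move: zS; rewrite !inE orbC.
- by rewrite setUC.
by exists K; split=> //; rewrite eq_sym.
Qed.

Lemma insep_of_card k u v F G : opt F -> #|rootset F|.+1 = k -> opt G -> #|rootset G| = k ->
  (forall K, opt K -> #|rootset K| = k -> rootof K u = rootof K v) -> insep u v.
Proof.
move=> oF Fk oG Gk Hk; apply/insepP => H oH; apply/eqP; apply: contraT => sH.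
(* A separating optimal forest with fewest roots has at most [k] of them, by removal against [F];
   roots are then added one at a time up to [k], by comparison with [G]. *)
case: (@arg_minnP _ H (fun K => opt K && (rootof K u != rootof K v))
  (fun K => #|rootset K|)); first by rewrite oH.
move=> {oH sH}{}H /andP [oH sH] minH.
have leH : #|rootset H| <= k.
  rewrite leqNgt; apply/negP => lt; rewrite -Fk in lt.
  have [K [oK ltK sK]] := separate_fewer_roots oH oF lt sH.
  by have := minH K; rewrite oK sK leqNgt ltK => /(_ isT).
have {minH} up n : #|rootset H| <= n <= k ->
    exists K, [/\ opt K, #|rootset K| = n & rootof K u != rootof K v].
  elim: n => [|n IH] /andP [le1 le2].
    by exists H; split=> //; apply/eqP; rewrite -leqn0.
  move: le1; rewrite leq_eqVlt => /orP [/eqP Hn|le1]; first by exists H.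
  have [|K [oK Kn sK]] := IH; first by rewrite (ltnW le2) andbT.
  by rewrite -Kn; apply: separate_more_roots oK oG _ sK; rewrite Kn Gk.
have [|K [oK Kk]] := up k; first by rewrite leH leqnn.
by rewrite (Hk K) ?eqxx.
Qed.

End RootCount.

(** * The penalty per root *)
Section Penalty.
Variables (R : realFieldType) (T : finType) (Varc : rel T) (v : T -> T -> R).
Implicit Types (f g h F G H : {ffun T -> option T}).

Definition penalized (lam : R) x (o : option T) := if o is Some y then v x y else lam.

Definition allowed x (o : option T) := if o is Some y then Varc x y else true.

Notation forest := (forest allowed).

Definition weight f : R := cost (penalized 0) setT f.

Definition min_forest k f :=
  [/\ forest f, #|rootset f| = k &
   forall g, forest g -> #|rootset g| = k -> (weight f <= weight g)%R].

Lemma cost_penalized lam f :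
  cost (penalized lam) setT f = (weight f + lam *+ #|rootset f|)%R.
Proof.
have -> : (lam *+ #|rootset f|)%R = (\sum_(x in setT) if f x == None then lam else 0)%R.
  by rewrite -big_mkcondr -sumr_const; apply: eq_bigl => x; rewrite !inE.
rewrite /weight /cost -big_split /=; apply: eq_bigr => x _ /=.
by case: (f x) => [y|] /=; rewrite ?addr0 ?add0r.
Qed.

Lemma cost_swap w P f g :
  (cost w setT (mix P f g) + cost w setT (mix P g f) =
   cost w setT f + cost w setT g :> R)%R.
Proof. by rewrite !cost_mix !(cost_split w P) addrACA [RHS]addrACA [X in (_ + X)%R]addrC. Qed.

Lemma swap_forest f g r : forest f -> forest g ->
  forest (mix (treeset f r) f g) /\ forest (mix (treeset f r) g f).
Proof.
move=> ff fg; have [af _] := andP ff; have [ag _] := andP fg.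
split; apply: forest_mix => //; first by apply: mix_acyc_stays => //; apply: treeset_stays.
by apply: mix_acyc_noenter => //; apply: treeset_noenter.
Qed.

Section Critical.
Variables (k : nat) (F G : {ffun T -> option T}).
Hypotheses (mF : min_forest k F) (mG : min_forest k.+1 G).

(** The penalty at which [F] and [G], with [k] and [k.+1] roots, have equal penalized cost. *)
Let lam := (weight F - weight G)%R.
Notation pcost := (cost (penalized lam) setT).

Let pcostFG : pcost F = pcost G.
Proof.
have [_ Fk _] := mF; have [_ Gk _] := mG.
by rewrite !cost_penalized Fk Gk mulrS addrA [(_ + lam)%R]addrC subrK.
Qed.

Let fF : forest F. Proof. by case: mF. Qed.
Let fG : forest G. Proof. by case: mG. Qed.

Let le_k f : forest f -> #|rootset f| = k -> (pcost F <= pcost f)%R.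
Proof.
have [_ Fk minF] := mF => ff fk.
by rewrite !cost_penalized Fk fk lerD2r minF.
Qed.

Let le_k1 f : forest f -> #|rootset f| = k.+1 -> (pcost F <= pcost f)%R.
Proof.
have [_ Gk minG] := mG => ff fk.
by rewrite pcostFG !cost_penalized Gk fk lerD2r minG.
Qed.

(** Exchanging a tree of [f] free of roots of [F] gives a forest with [k.+1] roots and one with a
    root less than [f]; their costs add up to those of [f] and [F]. *)
Let le_more n f : forest f -> #|rootset f| = k.+1 + n -> (pcost F <= pcost f)%R.
Proof.
elim: n f => [|n IH] f ff; first by rewrite addn0; apply: le_k1.
rewrite addnS => fk; have [af _] := andP ff; have [_ Fk _] := mF.
have [|r [fr dis]] := @root_free_tree _ f F _ af; first by rewrite fk Fk ltnS leqW // leq_addr.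
have [c1 c2] := swap_card af fr dis; have [m1 m2] := swap_forest r ff fF.
rewrite -(lerD2r (pcost F)) -(cost_swap _ (treeset f r) f F) lerD //.
  by apply: le_k1; rewrite // c1 Fk.
by apply: IH => //; apply: succn_inj; rewrite c2.
Qed.

(** The mirror image: a tree of [G] free of roots of [f] is exchanged. *)
Let le_less n f : forest f -> #|rootset f| + n = k -> (pcost F <= pcost f)%R.
Proof.
elim: n f => [|n IH] f ff; first by rewrite addn0; apply: le_k.
rewrite addnS => fk; have [aG _] := andP fG; have [_ Gk _] := mG.
have [|r [Gr dis]] := @root_free_tree _ G f _ aG; first by rewrite Gk -fk ltnS leqW // leq_addr.
have [c1 c2] := swap_card aG Gr dis; have [m1 m2] := swap_forest r fG ff.
rewrite -(lerD2l (pcost G)) -(cost_swap _ (treeset G r) G f) -pcostFG lerD //.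
  by apply: IH => //; rewrite c1 addSn.
by apply: le_k => //; apply: succn_inj; rewrite c2.
Qed.

Let le_all f : forest f -> (pcost F <= pcost f)%R.
Proof.
move=> ff; have [le|lt] := leqP #|rootset f| k.
  by apply: (le_less (n := k - #|rootset f|)) => //; rewrite subnKC.
by apply: (le_more (n := #|rootset f| - k.+1)) => //; rewrite subnKC.
Qed.

Lemma critical_opt : opt (penalized lam) allowed F.
Proof. by rewrite /opt fF; apply/forallP => g; apply/implyP; apply: le_all. Qed.

Lemma critical_optS f : #|rootset f| = k.+1 ->
  opt (penalized lam) allowed f <-> min_forest k.+1 f.
Proof.
move=> fk; have [_ Gk minG] := mG; split=> [of_|[ff _ minf]].
  split=> //; first exact: opt_forest of_.
  by move=> g fg gk; have := opt_le of_ fg; rewrite !cost_penalized fk gk lerD2r.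
rewrite /opt ff; apply/forallP => g; apply/implyP => /le_all; apply: le_trans.
by rewrite pcostFG !cost_penalized Gk fk lerD2r minf.
Qed.

End Critical.

(** Some vertex is not a root; deleting its arc adds one root, so there are forests to minimize
    over. *)
Lemma min_forest_ex k F : forest F -> #|rootset F| = k -> k < #|T| ->
  exists G, min_forest k.+1 G.
Proof.
move=> fF Fk kT; have [aF vF] := andP fF.
have [x xF] : exists x, x \notin rootset F.
  apply/existsP; apply: contraLR kT => /existsPn all; rewrite -leqNgt -Fk.
  by apply: subset_leq_card; apply/subsetP => x _; have := all x; rewrite negbK.
pose N : {ffun T -> option T} := [ffun=> None].
have aN : acyc N.
  by apply/forallP => y; apply/existsP; exists y; rewrite reach_refl ffunE.
have fM : forest (mix [set x] N F).
  apply: forest_mix => //.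
    by apply/andP; split=> //; apply/forallP => y; rewrite ffunE.
  by apply: mix_acyc_stays => // y z _; rewrite ffunE.
have Mk : #|rootset (mix [set x] N F)| = k.+1.
  have -> : rootset (mix [set x] N F) = x |: rootset F.
    apply/setP => y; rewrite !inE; have [->|yx] := eqVneq y x.
      by rewrite mixT ?inE // ffunE.
    by rewrite mixN // inE.
  by rewrite cardsU1 xF Fk.
pose P f := forest f && (#|rootset f| == k.+1).
have PM : P (mix [set x] N F) by rewrite /P fM Mk eqxx.
case: (arg_minP weight PM) => G /andP [fG /eqP Gk] minG.
by exists G; split=> // g fg gk; apply: minG; rewrite /P fg gk eqxx.
Qed.

End Penalty.

(** * Arc sets as functions *)
Section ArcSets.
Variable T : finType.
Implicit Types (f g : {ffun T -> option T}) (A : {set T * T}) (S : {set T}).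

Definition arcs f : {set T * T} := [set a | f a.1 == Some a.2].

Lemma arcs_forest f : acyc f -> is_forest_arcs (arcs f).
Proof.
move=> af; split=> [x|[x [y [xy yx]]]].
  apply/card_le1_eqP => y z; rewrite !inE /= => /eqP -> /eqP [] //.
have /negP [] : ~~ reach f y x by apply: reach_acyc => //; move: xy; rewrite inE => /eqP.
rewrite /reach -(@eq_connect _ (arel (arcs f))) // => a b.
by rewrite /arel inE.
Qed.

Lemma forest_arcs_fun A : is_forest_arcs A -> exists2 f, acyc f & A = arcs f.
Proof.
move=> [deg cyc]; pose f : {ffun T -> option T} := [ffun x => [pick y | (x, y) \in A]].
have fA x y : (f x == Some y) = ((x, y) \in A).
  rewrite ffunE; case: pickP => [z xz|no]; last by rewrite no.
  apply/eqP/idP => [[<-] //|xy]; congr Some.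
  by apply: (card_le1_eqP (deg x)); rewrite inE.
exists f; last by apply/setP => -[x y]; rewrite inE fA.
(* Without cycles the tail of an arc cannot be reached from its head, so the number of reachable
   vertices drops along arcs. *)
apply: (acyc_rank (rk := fun x => #|[set z | connect (arel A) x z]|)) => x y /eqP.
rewrite fA => xy; apply: proper_card; apply/properP; split.
  apply/subsetP => z; rewrite !inE; apply: connect_trans; exact: connect1.
exists x; rewrite !inE ?connect0 //; apply/negP => yx.
by apply: cyc; exists x, y.
Qed.

Lemma connect_arcs f x y : acyc f ->
  connect (symrel (arcs f)) x y = (rootof f x == rootof f y).
Proof.
move=> af; have sym : connect_sym (symrel (arcs f)).
  by apply: sym_connect_sym => a b; rewrite /symrel orbC.
have sub a b : reach f a b -> connect (symrel (arcs f)) a b.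
  by apply: connect_sub => c d fc; apply: connect1; rewrite /symrel inE /= fc.
apply/idP/eqP => [|xy].
  case/connectP => p; elim: p x => [|z p IH] x /=; first by move=> _ ->.
  case/andP => + /IH h /h <-; rewrite /symrel !inE /= => /orP [] /eqP fx.
    exact: rootof_step.
  by rewrite (rootof_step af fx).
apply: connect_trans (sub _ _ (reach_rootof x af)) _.
by rewrite sym xy; apply/sub/reach_rootof.
Qed.

Lemma mem_tree_sets f B : acyc f ->
  B \in tree_sets (arcs f) <-> exists x, B = treeset f (rootof f x).
Proof.
move=> af; have eqB x : [set y | connect (symrel (arcs f)) x y] = treeset f (rootof f x).
  by apply/setP => y; rewrite !inE connect_arcs // eq_sym.
by split=> [/imsetP [x _ ->]|[x ->]]; [exists x|apply/imsetP; exists x].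
Qed.

Lemma card_tree_sets f : acyc f -> #|tree_sets (arcs f)| = #|rootset f|.
Proof.
move=> af; rewrite -(@card_in_imset _ _ (treeset f) (rootset f)).
  apply: eq_card => B; apply/idP/imsetP => [/(mem_tree_sets _ af) [x ->]|[r]].
    by exists (rootof f x); rewrite // inE rootof_none.
  rewrite inE => /eqP fr ->; apply/(mem_tree_sets _ af); exists r.
  by rewrite rootof_stop.
move=> x y; rewrite !inE => /eqP fx /eqP fy /setP /(_ x).
by rewrite !inE rootof_stop // eqxx => /esym /eqP.
Qed.

Lemma Upsilon_arcs (R : realFieldType) (v : T -> T -> R) f :
  Upsilon v (arcs f) = weight v f.
Proof.
rewrite /Upsilon /weight /cost /penalized.
rewrite (eq_bigl (fun a : T * T => predT a.1 && (f a.1 == Some a.2))); last by move=> a; rewrite inE.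
rewrite -(pair_big_dep predT (fun x y => f x == Some y) v) /=.
rewrite [RHS](eq_bigl predT); last by move=> x; rewrite inE.
apply: eq_bigr => x _; case: (f x) => [y|]; last by rewrite big_pred0.
by apply: big_pred1 => z; rewrite eq_sym.
Qed.

Lemma forest_k_arcs (Varc : rel T) k f :
  forest_k Varc k (arcs f) /\ acyc f <->
  forest (allowed Varc) f /\ #|rootset f| = k.
Proof.
split=> [[[[/subsetP sub _]]] + af|[/andP [af /forallP vf] fk]].
  rewrite card_tree_sets // => fk; split=> //; apply/andP; split=> //.
  apply/forallP => x; case fx: (f x) => [y|//] /=.
  by have := sub (x, y); rewrite !inE /= fx eqxx => /(_ isT).
split=> //; split; last by rewrite card_tree_sets.
split; last exact: arcs_forest.
apply/subsetP => -[x y]; rewrite !inE /= => /eqP fx.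
by have := vf x; rewrite fx.
Qed.

Lemma minimal_forest_arcs (R : realFieldType) (Varc : rel T) (v : T -> T -> R) k f :
  acyc f -> minimal_forest Varc v k (arcs f) <-> min_forest Varc v k f.
Proof.
move=> af; split=> [[ff min_f]|[ff fk min_f]].
  have [fo fk] := (forest_k_arcs Varc k f).1 (conj ff af).
  split=> // g fg gk; rewrite -!Upsilon_arcs; apply: min_f.
  by have [] := (forest_k_arcs Varc k g).2 (conj fg gk).
split; first by have [] := (forest_k_arcs Varc k f).2 (conj ff fk).
move=> A fA; have [[_ /forest_arcs_fun [g ag eqA]] _] := fA.
rewrite {}eqA in fA *; have [fg gk] := (forest_k_arcs Varc k g).1 (conj fA ag).
by rewrite !Upsilon_arcs; apply: min_f.
Qed.

Lemma induced_arcs f S : induced (arcs f) S = arcs (restrict S f).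
Proof.
apply/setP => -[x y]; rewrite !inE /= restrictE.
case: (f x) => [z|//]; apply/andP/eqP => [[/eqP [->] ->] //|].
by case: ifP => // xz [<-].
Qed.

Lemma atom_inseparable (R : realFieldType) (Varc : rel T) (v : T -> T -> R) k E x y :
  is_atom (alg_k Varc v k) E -> x \in E ->
  (y \in E <-> forall f, min_forest Varc v k f -> rootof f x = rootof f y).
Proof.
move=> [_ [algE atom]] xE; split=> [yE f mf|insep].
  have [/andP [af _] _ _] := mf.
  have algB : alg_k Varc v k (treeset f (rootof f x)).
    move=> C gen _ _; apply: gen; exists (arcs f); split.
      exact/minimal_forest_arcs.
    by apply/mem_tree_sets => //; exists x.
  have [/setP /(_ x)|/setP /(_ y)] := atom _ algB; first by rewrite !inE xE eqxx.
  by rewrite !inE yE /= => /eqP.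
(* The generated algebra is tested on the family of sets that do not separate [x] from [y]. *)
have := algE [set B : {set T} | (x \in B) == (y \in B)]; rewrite inE xE => H.
suff /eqP <- : true == (y \in E) by [].
apply: H => [B [A [mA BA]]|B|B1 B2].
- have [[[_ /forest_arcs_fun [f af eqA]] _] _] := mA.
  rewrite {}eqA in mA BA; have [z ->] := (mem_tree_sets _ af).1 BA.
  by rewrite !inE (insep f) //; apply/minimal_forest_arcs.
- by rewrite !inE => /eqP ->.
- by rewrite !inE => /eqP -> /eqP ->.
Qed.

End ArcSets.

Theorem theorem6 (R : realFieldType) (T : finType) (Varc : rel T)
    (v : T -> T -> R) (k : nat) :
  has_spanning_tree Varc ->
  (2 <= k <= #|T|)%N ->
  forall F : {set T * T}, minimal_forest Varc v k.-1 F ->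
  forall E : {set T}, is_atom (alg_k Varc v k) E ->
  is_tree E (induced F E).
Proof.
(* After the case split, [k] counts the trees of the given minimal forest, one less than in the
   statement. *)
move=> _ /andP []; case: k => // k _ kT A mA E atomE /=.
have [[[_ /forest_arcs_fun [F aF eqA]] _] _] := mA.
rewrite {}eqA in mA *; have mF := (minimal_forest_arcs Varc v k aF).1 mA.
have [fF Fk _] := mF; have [G mG] := min_forest_ex v fF Fk kT.
have [_ Gk _] := mG; have oF := critical_opt mF mG.
have optk := critical_optS mF mG.
have [/set0Pn [e eE] _] := atomE.
set w := penalized _ _ in oF optk.
have oG := (optk G Gk).2 mG.
have exO : exists K, opt w (allowed Varc) K by exists F.
(* Sharing a tree in all optimal forests with [k.+1] roots forces sharing one in all optimal
   forests, so the atom is an inseparability class. *)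
have eqE : E = cls w (allowed Varc) e.
  apply/setP => x; rewrite inE; apply/idP/idP => [xE|/insepP ex].
    apply: (insep_of_card oF (congr1 S Fk) oG Gk) => K oK Kk.
    exact: ((atom_inseparable x atomE eE).1 xE K ((optk K Kk).1 oK)).
  apply/(atom_inseparable x atomE eE) => f mf; apply: ex.
  by have [_ fk _] := mf; apply/optk.
have [so _] := cls_solid_flat e exO.
rewrite induced_arcs; have aR := acyc_restrict E aF; split; [|split; [|split]].
- apply/subsetP => -[x y]; rewrite !inE /= => /eqP /restrict_some [_ -> ->] //.
- exact: arcs_forest.
- by apply/set0Pn; exists e.
(* [F] is itself optimal, so by solidity all its paths restricted to [E] end at the same vertex. *)
move=> x y xE yE; rewrite connect_arcs //; apply/eqP.
by rewrite eqE in xE yE *; apply: so.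
Qed.
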